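(* For all simple graphs $G$, the graphic matroid of $G$ has complexity $1$.
   Context: $\{0,1\}$ is identified with the field $\mathbb{F}_2$, and $[k]=\{1,\ldots,k\}$. A graph is simple if it has no self-loops and no parallel edges. For a simple graph $G$ with $k$ edges, the graphic matroid of $G$ is the binary matroid represented by vectors $v_1,\ldots,v_k\in\{0,1\}^k$, associated with the edges of $G$, such that a set $S\subseteq\{v_1,\ldots,v_k\}$ has a linear dependency if and only if the associated set of edges contains a cycle. Given a binary matroid $\mathcal{M}$ represented by $v_1,\ldots,v_k\in\{0,1\}^k$, we say that $\mathcal{M}$ has complexity $c$ at coordinate $i$ if we can partition $\{v_j\}_{j\in[k]\setminus\{i\}}$ into $c+1$ classes such that $v_i$ is not in the span of any of the classes. We say that $\mathcal{M}$ has complexity $c$ if $c$ is the minimum such that $\mathcal{M}$ has complexity $c$ at coordinate $i$ for all $i\in[k]$.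
   Formalization: Since complexity is a minimum, the graphic matroid of a forest has complexity 0, not 1; the formal statement says that the complexity is at most 1 for all simple graphs G and exactly 1 when G contains a cycle. *)

(* Defs.v *)
From mathcomp Require Import all_boot all_algebra.

Set Implicit Arguments.
Unset Strict Implicit.
Unset Printing Implicit Defensive.

Import GRing.Theory.

Local Open Scope ring_scope.

Record simple_graph (V : finType) := SimpleGraph {
  adj : rel V;
  adj_sym : symmetric adj;
  adj_irr : irreflexive adj
}.

Definition edge_set (V : finType) (G : simple_graph V) : {set {set V}} :=
  [set [set p.1; p.2] | p : V * V & adj G p.1 p.2].

Definition enumerates_edges (V : finType) (G : simple_graph V) (k : nat)
    (edge : 'I_k -> {set V}) : Prop :=
  injective edge /\ [set edge i | i : 'I_k] = edge_set G.

(* A cycle is given by its vertices x_0, ..., x_(m-1), pairwise distinct with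
   m >= 3, the pairs {x_i, x_(i+1 mod m)} all lying in F. *)
Definition contains_cycle (V : finType) (F : {set {set V}}) : Prop :=
  exists c : seq V,
    [/\ (2 < size c)%N, uniq c & cycle (fun x y => [set x; y] \in F) c].

(* Sets of vectors are sets of indices, i.e. subfamilies of v: two equal
   vectors with different indices are dependent. *)
Definition represents_graphic_matroid (V : finType) (k : nat)
    (edge : 'I_k -> {set V}) (v : 'I_k -> 'rV['F_2]_k) : Prop :=
  forall S : {set 'I_k},
    ~~ free [seq v i | i in S] <-> contains_cycle [set edge i | i in S].

(* The partition is given by its class map [cl]; some of the c + 1 classes may
   be empty, and the value of [cl] at i plays no role. *)
Definition complexity_at (k : nat) (v : 'I_k -> 'rV['F_2]_k)
    (c : nat) (i : 'I_k) : Prop :=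
  exists cl : 'I_k -> 'I_c.+1, forall a : 'I_c.+1,
    v i \notin <<[seq v j | j in [set j | (j != i) && (cl j == a)]]>>%VS.

Definition has_complexity (k : nat) (v : 'I_k -> 'rV['F_2]_k) (c : nat) : Prop :=
  (forall i, complexity_at v c i) /\
  (forall c' : nat, (forall i, complexity_at v c' i) -> (c <= c')%N).

(* Main.v *)
Require Import Defs.
From mathcomp Require Import all_boot all_algebra.

(** Let [x] and [y] be the ends of the edge [i].  Put the other edges at [x] in
one class and the edges that miss [x] in the other.  Since the graph has no
parallel edges, the first class misses [y], so each class misses an end of [i].
This is enough ([notin_span_missing_end]): if [v i] were in the span of a class
[S] missing an end [z] of [i], it would be in the span of a free [T] included
in [S] ([free_subfamily_span]), and [T] with [i] would be dependent, hence
would contain a cycle.  As a cycle has two edges at each of its vertices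
([cycle_two_edges]) and [i] is the only edge at [z], this cycle avoids [z] and
therefore [i]; it is a cycle in [T], which is absurd since [T] is free.
So the complexity is at most 1 everywhere ([graphic_complexity_at1]).

A single class shows [complexity_at v 0 i] exactly when [v i] is not in the span
of all the other vectors, so complexity 0 at all coordinates means that [v] is
free ([complexity0_free]), that is, that the graph is a forest.  Complexity
exactly 1 thus characterises the graphs with a cycle, and forests have
complexity 0. *)

Set Implicit Arguments.
Unset Strict Implicit.
Unset Printing Implicit Defensive.

(** * Indexed families of vectors *)

Section Families.

Variables (K : fieldType) (U : vectType K) (I : finType) (v : I -> U).
Implicit Types (i : I) (S : {set I}).

Local Notation fam S := [seq v j | j in S].

Lemma free_famU1 i S : i \notin S ->
  free (fam (i |: S)) = (v i \notin <<fam S>>%VS) && free (fam S).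
Proof.
move=> iS; rewrite -free_cons; apply: perm_free.
rewrite -[v i :: _]/(map v (i :: enum S)) perm_map //.
apply: uniq_perm; rewrite /= ?enum_uniq ?mem_enum ?iS //.
by move=> j; rewrite inE !mem_enum !inE.
Qed.

Lemma sub_span_fam (S T : {set I}) : S \subset T -> (<<fam S>> <= <<fam T>>)%VS.
Proof.
move=> /subsetP sST; apply: sub_span => _ /mapP[j + ->]; rewrite mem_enum => jS.
by apply: map_f; rewrite mem_enum sST.
Qed.

(** Freeness of a list only compares each vector with the later ones; here each
vector is compared with all the others, which does not depend on an order. *)
Lemma free_famP S :
  reflect {in S, forall i, v i \notin <<fam (S :\ i)>>%VS} (free (fam S)).
Proof.
apply: (iffP idP) => [frS i iS | ].
  by move: frS; rewrite -{1}(setD1K iS) free_famU1 ?setD11 // => /andP[].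
have [n ltSn] := ubnP #|S|; elim: n => // n IHn in S ltSn * => ind.
have [-> | [i iS]] := set_0Vmem S; first by rewrite /image_mem enum_set0 nil_free.
rewrite -(setD1K iS) free_famU1 ?setD11 // ind //=.
apply: IHn => [|j]; first by rewrite (cardsD1 i) iS in ltSn.
case/setD1P=> _ jS; apply: contra (ind j jS); apply: subvP.
by rewrite sub_span_fam // setSD // subD1set.
Qed.

(** A vector in the span of the others can be dropped without changing the
span; dropping such vectors for as long as there are any ends with a basis. *)
Lemma free_subfamily_span S :
  exists2 T : {set I}, T \subset S & free (fam T) /\ <<fam T>>%VS = <<fam S>>%VS.
Proof.
have [n ltSn] := ubnP #|S|; elim: n => // n IHn in S ltSn *.
have [frS | /free_famP depS] := boolP (free (fam S)); first by exists S.
have /exists_inP[i iS vi] : [exists i in S, v i \in <<fam (S :\ i)>>%VS].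
  by apply/exists_inPn.
have [|T sT [frT spT]] := IHn (S :\ i).
  by rewrite (cardsD1 i) iS in ltSn.
exists T; first exact: subset_trans sT (subD1set _ _).
split=> //; rewrite spT; apply/eqP; rewrite eqEsubv sub_span_fam ?subD1set //=.
apply/span_subvP => _ /mapP[j + ->]; rewrite mem_enum => jS.
have [-> // | ji] := eqVneq j i.
by apply/memv_span/map_f; rewrite mem_enum !inE ji.
Qed.

End Families.

(** * Cycles in a set of edges *)

Lemma cycle_two_edges (V : finType) (F : {set {set V}}) (c : seq V) (z : V) :
    (2 < size c)%N -> uniq c -> cycle (fun x y => [set x; y] \in F) c ->
    z \in c ->
  exists A B : {set V}, [/\ A \in F, B \in F, z \in A, z \in B & A != B].
Proof.
move=> + + + zc; case/rot_to: zc => n p def_c.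
rewrite -(size_rot n) -(rot_uniq n) -(rot_cycle n) {c}def_c.
case: p => [|a [|b q]] //= _ /and4P[zabq abq _ _] /and3P[za _].
rewrite rcons_path => /andP[_ lz].
exists [set z; a], [set last b q; z]; split; rewrite ?set21 ?set22 //.
have a_z : a != z by move: zabq; rewrite inE eq_sym => /norP[].
have a_l : a != last b q by apply: contraNneq abq => ->; exact: mem_last.
apply/eqP => /setP/(_ a).
by rewrite !inE eqxx orbT (negbTE a_z) (negbTE a_l).
Qed.

(** The two edges of a cycle at [z] would both be [i], so the cycle avoids [z]
and cannot use [i]. *)
Lemma contains_cycle_pendant (V I : finType) (edge : I -> {set V})
    (i : I) (S : {set I}) (z : V) :
    z \in edge i -> {in S, forall j, z \notin edge j} ->
  contains_cycle [set edge j | j in i |: S] ->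
  contains_cycle [set edge j | j in S].
Proof.
move=> zi zS [c [c3 c_uniq c_cyc]]; exists c; split=> //.
have edge_z (A : {set V}) :
    A \in [set edge j | j in i |: S] -> z \in A -> A = edge i.
  by case/imsetP=> j /setU1P[-> // | /zS/negbTE jz] ->; rewrite jz.
have zc : z \notin c.
  apply/negP => /(cycle_two_edges c3 c_uniq c_cyc)[A [B [AF BF zA zB]]].
  by rewrite (edge_z A) // (edge_z B) // eqxx.
apply: (sub_in_cycle (P := predC1 z)) c_cyc; last first.
  by apply/allP => x xc; apply: contraNneq zc => <-.
move=> x y; rewrite !inE => xz yz /imsetP[j /setU1P[-> | jS] def_xy].
  by move: zi; rewrite -def_xy !inE !(eq_sym z) (negbTE xz) (negbTE yz).
by rewrite def_xy imset_f.
Qed.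

(** * Complexity of graphic matroids *)

Section Graphic.

Variables (V : finType) (k : nat).
Variables (edge : 'I_k -> {set V}) (v : 'I_k -> 'rV['F_2]_k).

(** A dependency among [S] and [i] may live inside [S] and say nothing about
[v i]; replacing [S] by a free subfamily with the same span excludes this. *)
Lemma notin_span_missing_end (i : 'I_k) (S : {set 'I_k}) (z : V) :
    represents_graphic_matroid edge v ->
    z \in edge i -> {in S, forall j, z \notin edge j} ->
  v i \notin <<[seq v j | j in S]>>%VS.
Proof.
move=> rep zi zS.
have [T /subsetP sTS [frT <-]] := free_subfamily_span v S.
have zT : {in T, forall j, z \notin edge j} by move=> j /sTS; exact: zS.
have iT : i \notin T by apply: contraL zi; exact: zT.
apply/negP => vi; suff: ~~ free [seq v j | j in T] by rewrite frT.
apply/rep/(contains_cycle_pendant zi zT)/rep.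
by rewrite free_famU1 // vi.
Qed.

Lemma edge_ends (G : simple_graph V) (i : 'I_k) :
  enumerates_edges G edge -> exists x y : V, x != y /\ edge i = [set x; y].
Proof.
case=> _ /setP/(_ (edge i)); rewrite imset_f // => /esym/imsetP[[x y]].
rewrite inE /= => xy ->; exists x, y; split=> //.
by apply: contraTneq xy => ->; rewrite adj_irr.
Qed.

Lemma graphic_complexity_at1 (G : simple_graph V) (i : 'I_k) :
    enumerates_edges G edge -> represents_graphic_matroid edge v ->
  complexity_at v 1 i.
Proof.
move=> enumG rep; have [x [y [xy def_i]]] := edge_ends i enumG.
exists (fun j => if x \in edge j then ord_max else ord0) => a.
have [-> | a0] := eqVneq a ord0.
  apply: (notin_span_missing_end (z := x) rep); first by rewrite def_i set21.
  by move=> j; rewrite inE; case: ifP => //; rewrite andbF.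
apply: (notin_span_missing_end (z := y) rep); first by rewrite def_i set22.
move=> j; rewrite inE => /andP[ji]; case: ifP => [xj _ | _ /eqP a_0]; last first.
  by rewrite -a_0 eqxx in a0.
(* Two distinct ends determine an edge, so [j] would be parallel to [i]. *)
apply: contra ji => yj; apply/eqP; case: (enumG) => edge_inj _; apply: edge_inj.
have [s [t [st def_j]]] := edge_ends j enumG.
apply/eqP; rewrite eq_sym eqEcard {2}def_j {2}def_i !cards2 xy st andbT.
by apply/subsetP => w; rewrite def_i => /set2P[] ->.
Qed.

End Graphic.

Lemma complexity0_free (k : nat) (v : 'I_k -> 'rV['F_2]_k) :
  (forall i, complexity_at v 0 i) <-> free [seq v i | i in [set: 'I_k]].
Proof.
have one_class (cl : 'I_k -> 'I_1) a i :
    [set j | (j != i) && (cl j == a)] = [set: 'I_k] :\ i.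
  by apply/setP => j; rewrite !inE !ord1 eqxx.
split=> [cpl0 | /free_famP fr i].
  by apply/free_famP => i _; have [cl /(_ ord0)] := cpl0 i; rewrite one_class.
by exists (fun=> ord0) => a; rewrite one_class fr.
Qed.

Theorem lemma2p4 (V : finType) (G : simple_graph V) (k : nat)
    (edge : 'I_k -> {set V}) (v : 'I_k -> 'rV['F_2]_k) :
  enumerates_edges G edge ->
  represents_graphic_matroid edge v ->
  (exists c : nat, (c <= 1)%N /\ has_complexity v c) /\
  (contains_cycle (edge_set G) -> has_complexity v 1).
Proof.
move=> enumG rep.
have cpl1 i : complexity_at v 1 i by exact: graphic_complexity_at1 enumG rep.
have dep_cpl1 : ~~ free [seq v i | i in [set: 'I_k]] -> has_complexity v 1.
  by move=> dep; split=> // -[/complexity0_free | //]; rewrite (negbTE dep).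
split=> [|cycG].
  have [fr | /dep_cpl1 cpl] := boolP (free [seq v i | i in [set: 'I_k]]).
    by exists 0; split=> //; split=> //; apply/complexity0_free.
  by exists 1.
apply/dep_cpl1/rep; case: enumG => _ img_edge.
suff -> : [set edge i | i in [set: 'I_k]] = edge_set G by [].
rewrite -img_edge; apply/setP => A.
by apply/imsetP/imsetP=> -[i _ ->]; exists i; rewrite ?inE.
Qed.
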